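(* Let $K$ be an infinite compact space. Then $$c(K^{(\infty)},K)=\sup\Big\{|\Gamma| : C\big(K_{\Gamma,[0,1]}\big)\text{ embeds isometrically into }C(K)\Big\}.$$
   Context: All compact spaces are Hausdorff. $C(K)$ is the real Banach space of continuous real-valued functions on $K$ with the supremum norm; isometric embeddings are linear. Cantor--Bendixson derivatives: $S^{(0)}=S$, $S^{(1)}$ is the set of accumulation points of $S$, $S^{(\beta+1)}=(S^{(\beta)})^{(1)}$, and $S^{(\alpha)}=\bigcap_{\beta<\alpha}S^{(\beta)}$ for limit $\alpha$. The perfect kernel $S^{(\infty)}$ is the eventual constant value of $S^{(\alpha)}$. A cellular family in $S$ is a family of pairwise disjoint nonempty open subsets of $S$. For $A\subseteq S$, the relative cellularity $c(A,S)$ is the supremum of the cardinalities of cellular families $\mathcal U$ in $S$ such that $A\cap U\ne\emptyset$ for every $U\in\mathcal U$. For a nonempty set $\Gamma$ and a nonempty compact space $L$, $K_{\Gamma,L}$ is the one-point compactification of the disjoint union of $|\Gamma|$ many copies of $L$ if $\Gamma$ is infinite, and simply the disjoint union of $|\Gamma|$ copies of $L$ if $\Gamma$ is finite. The supremum is over nonempty sets $\Gamma$, and the supremum of the empty set is $0$. *)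

(* Defs.v *)
From HB Require Import structures.
From mathcomp Require Import all_boot all_order all_algebra.
From mathcomp Require Import all_classical all_reals all_analysis.
Import Order.TTheory GRing.Theory Num.Theory.
Import numFieldNormedType.Exports.

Set Implicit Arguments.
Unset Strict Implicit.
Unset Printing Implicit Defensive.

Local Open Scope classical_set_scope.
Local Open Scope card_scope.
Local Open Scope ring_scope.

(* Ordinals as well-founded trees. Different trees may denote the same ordinal;
   [osup f] denotes the supremum of the ordinals [f i], so limit ordinals are
   the suprema of families without a greatest element. *)
Inductive ord : Type :=
  | ozero : ord
  | osucc : ord -> ord
  | osup : forall I : Type, (I -> ord) -> ord.

Inductive ole : ord -> ord -> Prop :=
  | ole_zero b : ole ozero b
  | ole_succ a b : ole a b -> ole (osucc a) (osucc b)
  | ole_supr a (I : Type) (f : I -> ord) i : ole a (f i) -> ole a (osup f)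
  | ole_supl (I : Type) (f : I -> ord) b :
      (forall i, ole (f i) b) -> ole (osup f) b.

Section CantorBendixson.
Variable T : topologicalType.

(* Derivatives decrease (see [cb_derivative_antitone]), so at a limit ordinal
   the intersection over any cofinal family is the intersection over all smaller
   ordinals, and at a supremum which is attained it is the attained derivative. *)
Fixpoint cb_derivative (a : ord) : set T :=
  match a with
  | ozero => setT
  | osucc b => limit_point (cb_derivative b)
  | osup _ f => \bigcap_i cb_derivative (f i)
  end.

(* The value taken by the derivatives from some ordinal on; that such a value
   exists is [perfect_kernel_eventual]. *)
Definition perfect_kernel : set T :=
  [set x | exists a, forall b, ole a b -> cb_derivative b x].

Lemma cb_derivative_antitone a b :
  ole a b -> cb_derivative b `<=` cb_derivative a.
Proof.
elim=> {a b} [b//|a b _ sba|a I f i _ sfa|I f b _ sbf] x /=.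
- by move=> bx U /bx[y [yx by_ Uy]]; exists y; split => //; exact: sba.
- by move=> fx; apply: sfa; exact: fx.
- by move=> bx i _; exact: sbf.
Qed.

Lemma perfect_kernel_eventual :
  exists a, forall b, ole a b -> cb_derivative b = perfect_kernel.
Proof.
have ole_refl a : ole a a.
  elim: a => [|a aa|I f ff]; [exact: ole_zero|exact: ole_succ|].
  by apply: ole_supl => i; exact: ole_supr (ff i).
have /choice[f fP] : forall x, exists a, cb_derivative a x ->
    forall b, cb_derivative b x.
  move=> x; have [[a nax]|allx] := pselect (exists a, ~ cb_derivative a x).
    by exists a.
  exists ozero => _ b; apply: contrapT => nbx; apply: allx; by exists b.
exists (osup f) => b fb; apply/seteqP; split => x.
  move=> /(cb_derivative_antitone fb)/(_ x I)/fP allx.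
  by exists ozero => c _; exact: allx.
move=> [a ax]; pose J (i : bool) := if i then a else b.
have Jx : cb_derivative (osup J) x.
  by apply: ax; exact: (@ole_supr _ _ J true).
exact: Jx false I.
Qed.

End CantorBendixson.
Arguments cb_derivative T a : clear implicits.
Arguments perfect_kernel T : clear implicits.

(* [k] is the supremum of the cardinal numbers of the types satisfying [F]. *)
Definition is_card_sup (F : choiceType -> Prop) (k : choiceType) : Prop :=
  (forall G : choiceType, F G -> [set: G] #<= [set: k]) /\
  (forall k' : choiceType,
    (forall G : choiceType, F G -> [set: G] #<= [set: k']) ->
    [set: k] #<= [set: k']).

Definition cellular_family (T : topologicalType) (U : set (set T)) : Prop :=
  (forall u, U u -> open u /\ u !=set0) /\ trivIset U id.

(* [k] is the relative cellularity c(A, T). *)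
Definition is_relative_cellularity (T : topologicalType) (A : set T)
    (k : choiceType) : Prop :=
  is_card_sup (fun G : choiceType => exists U : set (set T),
    [/\ cellular_family U, forall u, U u -> A `&` u !=set0
      & [set: G] #= U]) k.

Definition copies (G : choiceType) (L : topologicalType) : topologicalType :=
  if `[< finite_set [set: G] >] then ({_ : G & L} : topologicalType)
  else (one_point_compactification {_ : G & L} : topologicalType).

Section ContinuousFunctions.
Variables (R : realType) (K : topologicalType).

Definition cont_pred : {pred K -> R^o} :=
  fun f => `[< continuous f >].

Lemma cont_submod_closed : submod_closed cont_pred.
Proof.
split; first by apply/asboolP => x; exact: cst_continuous.
move=> a f g /asboolP cf /asboolP cg; apply/asboolP => x.
by apply: cvgD; [apply: cvgZr; exact: cf|exact: cg].
Qed.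

HB.instance Definition _ :=
  GRing.isSubmodClosed.Build R (K -> R^o) cont_pred cont_submod_closed.

Record cont_fun : Type :=
  ContFun { cont_val :> K -> R^o; cont_valP : cont_val \in cont_pred }.

HB.instance Definition _ := [isSub for cont_val].
HB.instance Definition _ := [Choice of cont_fun by <:].
HB.instance Definition _ := [SubChoice_isSubLmodule of cont_fun by <:].

Definition sup_norm (f : cont_fun) : R := sup [set `|f x| | x in [set: K]].

End ContinuousFunctions.

Definition isometrically_embeds (R : realType) (L K : topologicalType) : Prop :=
  exists T : {linear cont_fun R L -> cont_fun R K},
    forall f, sup_norm (T f) = sup_norm f.

Definition unit_interval (R : realType) : topologicalType :=
  set_type (`[0, 1] : set R).

(* Main.v *)
(* Both sides are suprema over the same index sets, up to the empty one.

   If the disjoint open sets [U_i] meet the perfect kernel, a dyadic tree of open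
   sets meeting the kernel inside [U_i] yields [h_i : K -> [0, 1]] mapping a closed
   subset of [U_i] onto [0, 1]; with a Urysohn function [w_i] equal to 1 on that
   subset and 0 off [U_i], the map
     f |-> f(oo) + sum_i w_i (f(i, h_i) - f(oo))
   is an isometric embedding (without the terms f(oo) for finitely many copies).

   Conversely, let [T] be an isometric embedding and [1_i] the indicator function
   of the i-th copy. The sets [{|T 1_i| > 1/2}] are pairwise disjoint, because
   [1_i + 1_j] and [1_i - 1_j] have norm 1. Let [id_i] be the coordinate on the i-th
   copy. Testing [T] on tent functions peaking at [t] shows that
   [T id_i * T 1_i] maps the closed set [{|T 1_i| = 1}] onto [0, 1]; a minimal
   closed subset still mapped onto [0, 1] has no isolated points, so it lies in the
   perfect kernel. *)
Require Import Defs.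
From HB Require Import structures.
From mathcomp Require Import all_boot all_order all_algebra.
From mathcomp Require Import all_classical all_reals all_analysis.
Import Order.TTheory GRing.Theory Num.Theory.
From mathcomp Require Import ring lra.
Import numFieldNormedType.Exports.

Set Implicit Arguments.
Unset Strict Implicit.
Unset Printing Implicit Defensive.

Local Open Scope classical_set_scope.
Local Open Scope ring_scope.

(** * Suprema of cardinals *)

Lemma card_le_inj (T U : Type) (f : T -> U) (A : set T) (B : set U) :
  (forall x y, A x -> A y -> f x = f y -> x = y) -> f @` A `<=` B ->
  (A #<= B)%card.
Proof.
move=> finj fAB; apply: card_le_trans (subset_card_le fAB).
have /inj_card_eq : {in A &, injective f}.
  by move=> x y /set_mem ? /set_mem ? ?; exact: finj.
by rewrite card_eq_le => /andP[].
Qed.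

Lemma card_minimum (B : Type) (P : set (set B)) : P !=set0 ->
  exists2 A, P A & forall A', P A' -> (A #<= A')%card.
Proof.
move=> [A0 PA0].
(* Honig's argument: a maximal set of choice functions on [P] on which every
   evaluation is injective must exhaust one of the members of [P]. *)
pose Q : set (set (set B -> B)) := [set Y | forall A, P A ->
  (forall y, Y y -> A (y A)) /\
  (forall y z, Y y -> Y z -> y A = z A -> y = z)].
have [F FQ Ftot|Y [QY Ymax]] := @Zorn_bigcup _ Q.
  move=> A PA; split=> [y [X FX Xy]|y z [X FX Xy] [Z FZ Zz] yz].
    exact: (FQ _ FX _ PA).1.
  have [XZ|ZX] := Ftot _ _ FX FZ.
    exact: (FQ _ FZ _ PA).2 (XZ _ Xy) Zz yz.
  exact: (FQ _ FX _ PA).2 Xy (ZX _ Zz) yz.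
(* If every member of [P] had a point not hit by [Y], choosing such points would give one more
   choice function, against maximality. *)
have [A PA AY] : exists2 A, P A & A `<=` (fun y => y A) @` Y.
  apply: contrapT => noA.
  have notY A : P A -> exists a, A a /\ forall y, Y y -> y A <> a.
    move=> PA; apply: contrapT => na; apply: noA; exists A => // a Aa.
    apply: contrapT => nYa; apply: na; exists a; split=> // y Yy ya.
    by apply: nYa; exists y.
  have [a0 _] := notY _ PA0.
  have /choice[y yP] A : exists a, P A -> A a /\ forall z, Y z -> z A <> a.
    have [PA|nPA] := pselect (P A); last by exists a0.
    by have [a ?] := notY _ PA; exists a.
  apply: (Ymax (Y `|` [set y])).
    rewrite properEneq; split; last by left.
    apply/eqP => YE; have Yy : Y y by rewrite YE; right.
    exact: (yP _ PA0).2 _ Yy erefl.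
  move=> A PA; split=> [z [Yz|->]|z w [Yz|->] [Yw|->]] //.
  - exact: (QY _ PA).1.
  - exact: (yP _ PA).1.
  - exact: (QY _ PA).2.
  - by move/((yP _ PA).2 _ Yz).
  - by move/esym/((yP _ PA).2 _ Yw).
exists A => // A' PA'; apply: card_le_trans (subset_card_le AY) _.
apply: card_le_trans (card_image_le _ _) _.
apply: (@card_le_inj _ _ (fun y => y A')) => [y z Yy Yz|_ [y Yy <-]].
  exact: (QY _ PA').2.
exact: (QY _ PA').1.
Qed.

(** Both types sit in [T + U] as the ranges of the injections; the range of least cardinality maps
    injectively into the other. *)
Lemma card_le_total (T U : Type) :
  ([set: T] #<= [set: U])%card \/ ([set: U] #<= [set: T])%card.
Proof.
pose P : set (set (T + U)) := [set range inl; range inr].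
have [|A [->|->] Amin] := @card_minimum _ P.
- by exists (range inl); left.
- left; have := Amin _ (or_intror erefl).
  move=> lr; apply: card_le_trans (card_le_trans lr (card_image_le _ _)).
  by apply: (@card_le_inj _ _ inl) => [x y _ _ []|] //.
- right; have := Amin _ (or_introl erefl).
  move=> lr; apply: card_le_trans (card_le_trans lr (card_image_le _ _)).
  by apply: (@card_le_inj _ _ inr) => [x y _ _ []|] //.
Qed.

(** Among the subsets of [B] that dominate every [G] in [F], one of least cardinality is the
    supremum. Another upper bound [k'] is compared through a copy of it inside [B], or else
    dominates [B] itself. *)
Lemma is_card_sup_exists (F : choiceType -> Prop) (B : choiceType) :
  (forall G : choiceType, F G -> ([set: G] #<= [set: B])%card) ->
  exists k, is_card_sup F k.
Proof.
move=> FB.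
pose P : set (set B) :=
  [set A | forall G : choiceType, F G -> ([set: G] #<= A)%card].
have [|A PA Amin] := @card_minimum _ P; first by exists setT.
exists (set_type A); split=> [G /PA GA|k' Fk'].
  by rewrite (card_le_eqr (card_setT A)).
rewrite (card_le_eql (card_setT A)).
have [kB|Bk] := card_le_total k' B; last first.
  by apply: card_le_trans Bk; exact: card_leT.
have /card_subP[C Ck CB] := kB.
rewrite -(card_le_eqr Ck); apply: Amin => G FG /=.
by rewrite (card_le_eqr Ck); exact: Fk'.
Qed.

(** * Closed sets mapped onto the interval *)

Lemma dense_in_itself_cb_derivative (K : topologicalType) (M : set K) (a : ord) :
  M `<=` limit_point M -> M `<=` cb_derivative K a.
Proof.
move=> Mlim; elim: a => [//|a IH x /Mlim xM U /xM[y [yx My Uy]]|I f IH x Mx i _].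
  by exists y; split=> //; exact: IH.
exact: IH.
Qed.

Lemma unit_interval_limit_point (R : realType) :
  `[0, 1]%classic `<=` limit_point (`[0, 1]%classic : set R).
Proof.
move=> t /=; rewrite in_itv /= => /andP[t0 t1] U /nbhs_ballP[e /= e0 eU].
pose d := Num.min (e / 2) (1 / 2).
have d0 : 0 < d by rewrite lt_min !divr_gt0.
have de : d < e.
  by rewrite gt_min; apply/orP; left; rewrite ltr_pdivrMr// ltr_pMr// ltr1n.
have d2 : d <= 1 / 2 by rewrite ge_min lexx orbT.
have [th|th] := leP t (1 / 2).
  exists (t + d); split.
  - by rewrite gt_eqF// ltrDl.
  - by rewrite /= in_itv /=; lra.
  - by apply: eU; rewrite /ball /= opprD addNKr normrN gtr0_norm.
exists (t - d); split.
- by rewrite lt_eqF// ltrBlDr ltrDl.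
- by rewrite /= in_itv /=; lra.
- by apply: eU; rewrite /ball /= subKr gtr0_norm.
Qed.

Lemma interval_image_meets_kernel (R : realType) (K : topologicalType)
    (F : set K) (H : K -> R) :
  compact [set: K] -> closed F -> continuous H -> `[0, 1]%classic `<=` H @` F ->
  F `&` perfect_kernel K !=set0.
Proof.
move=> cK clF cH HF.
have ccl (A : set K) : closed A -> compact A.
  by move=> clA; apply: subclosed_compact clA cK _.
(* A minimal closed subset of [F] mapped onto the interval has no isolated
   point: removing one loses at most one value, hence none as the image stays
   closed. *)
pose Q : set (set K) := [set W | open W /\ `[0, 1]%classic `<=` H @` (F `\` W)].
have [C CQ Ctot|W [[oW HW] Wmax]] := @Zorn_bigcup _ Q.
  have [[W0 CW0]|C0] := pselect (C !=set0); last first.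
    rewrite bigcup0; last by move=> W CW; exfalso; apply: C0; exists W.
    by split; [exact: open0|rewrite setD0].
  split=> [|t t01]; first by apply: bigcup_open => W /CQ[].
  (* Compactness of the fibre over [t] handles the chain: the sets [D] minus [W], for [W] in the
     chain, form a filter base whose cluster point avoids every [W]. *)
  pose D := F `&` H @^-1` [set t].
  have clD : closed D.
    apply: closedI => //; apply: closed_comp => [x _|]; first exact: cH.
    exact: closed_eq.
  pose G := filter_from C (fun W => D `\` W).
  have GF : ProperFilter G.
    apply: filter_from_proper.
      apply: filter_from_filter; first by exists W0.
      move=> W1 W2 CW1 CW2; have [W12|W21] := Ctot _ _ CW1 CW2.
        exists W2 => // x [Dx nx]; split; split=> //.
        by move/W12.
      exists W1 => // x [Dx nx]; split; split=> //.
      by move/W21.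
    move=> W1 /CQ[_ /(_ _ t01)[x [Fx nx] Hx]].
    by exists x.
  have [|x [[Fx Hx] xG]] := ccl _ clD G GF; first by exists W0 => // x [].
  exists x => //; split=> // -[W1 CW1 W1x].
  have [||y [[_ nW1y] /nW1y]//] := xG (D `\` W1) W1; first by exists W1.
  by apply: open_nbhs_nbhs; split=> //; have [] := CQ _ CW1.
pose M := F `\` W.
have clM : closed M.
  by rewrite /M setDE; apply: closedI => //; exact: open_closedC.
have Mlim : M `<=` limit_point M.
  move=> x [Fx nWx]; apply: contrapT; rewrite not_limit_pointE => -[X xX MX].
  apply: (Wmax (W `|` X^°)).
    rewrite properEneq; split; last by left.
    by apply/eqP => WE; apply: nWx; rewrite WE; right.
  split; first by apply: openU => //; exact: open_interior.
  have clN : closed (H @` (F `\` (W `|` X^°))).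
    apply: compact_closed; first exact: Rhausdorff.
    apply: continuous_compact.
      exact: continuous_subspaceT.
    apply: ccl; rewrite setDE; apply: closedI => //; apply: open_closedC.
    by apply: openU => //; exact: open_interior.
  have HN s : `[0, 1]%classic s -> s != H x -> (H @` (F `\` (W `|` X^°))) s.
    move=> /HW[y [Fy nWy] Hy] sx; exists y => //; split=> // -[//|/interior_subset Xy].
    by move: sx; rewrite -Hy; have /= -> := MX y (conj (conj Fy nWy) Xy); rewrite eqxx.
  move=> t t01; apply: clN => U tU.
  have [tx|/eqP tx] := pselect (t = H x).
    have [s [st s01 Us]] := unit_interval_limit_point t01 tU.
    by exists s; split=> //; apply: HN => //; rewrite -tx.
  by exists t; split; [exact: HN|exact: nbhs_singleton].
have [|x Mx _] := HW 0; first by rewrite /= in_itv /= lexx ler01.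
exists x; split; first by case: Mx.
by exists ozero => b _; exact: (@dense_in_itself_cb_derivative _ M).
Qed.

(** * Maps from the perfect kernel onto the interval *)

Lemma continuous_uniform_approx (R : realType) (K : topologicalType)
    (f : K -> R) :
  (forall e, 0 < e -> exists2 g : K -> R,
    continuous g & forall x, `|f x - g x| <= e) -> continuous f.
Proof.
move=> fg x; apply/cvgrPdist_le => e e0.
have [g cg gf] := fg (e / 3) ltac:(lra).
have /cvgrPdist_le/(_ (e / 3) ltac:(lra)) := cg x.
apply: filterS => y gxy; have := gf x; have := gf y.
by move: gxy; rewrite !ler_norml; lra.
Qed.

Lemma half_pow_small (R : realType) (e : R) : 0 < e ->
  exists n, 2^-1 ^+ n < e :> R.
Proof.
move=> e0; have : (fun n => 2^-1 ^+ n : R) @ \oo --> 0.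
  by apply: cvg_expr; rewrite ger0_norm; lra.
move=> /cvgrPdist_lt/(_ _ e0)[n _ /(_ n)]/=; rewrite leqnn => /(_ isT).
by rewrite sub0r normrN ger0_norm ?exprn_ge0 ?invr_ge0//; exists n.
Qed.

(** The kernel is the derivative at some [a], and its points persist in the derivative at [osucc a].
    The supremum of [b] and [osucc a] avoids comparing the two trees. *)
Lemma perfect_kernel_limit_point (K : topologicalType) :
  perfect_kernel K `<=` limit_point (perfect_kernel K).
Proof.
have ole_refl a : ole a a.
  elim: a => [|a aa|I f ff]; [exact: ole_zero|exact: ole_succ|].
  by apply: ole_supl => i; exact: ole_supr (ff i).
have [a aP] := perfect_kernel_eventual K.
have Pa : cb_derivative K a = perfect_kernel K by exact: aP.
move=> x [b bx]; rewrite -Pa.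
pose J (i : bool) := if i then b else osucc a.
have /bx Jx : ole b (osup J) by exact: (@ole_supr _ _ J true).
exact: Jx false I.
Qed.

Section Compact.
Variables (R : realType) (K : topologicalType).
Hypotheses (cK : compact [set: K]) (hK : hausdorff_space K).
Local Notation P := (perfect_kernel K).

Lemma open_shrink (V : set K) (x : K) : open V -> V x ->
  exists W, [/\ open W, W x & closure W `<=` V].
Proof.
move=> oV Vx.
have [W xW WV] := compact_regular hK cK (@filterT _ (nbhs x) _)
  (open_nbhs_nbhs (conj oV Vx)).
exists W^°; split; [exact: open_interior|exact: nbhs_singleton (nbhs_interior xW)|].
by apply: subset_trans WV; apply: closureS; exact: interior_subset.
Qed.

(** One branching of the dyadic tree: the kernel has no isolated points, so [V] contains two of its
    points, which are separated and then given smaller neighbourhoods. *)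
Lemma perfect_kernel_split (V : set K) : open V -> P `&` V !=set0 ->
  exists W : bool -> set K,
    [/\ forall b, open (W b) /\ P `&` W b !=set0,
        forall b, closure (W b) `<=` V
      & closure (W true) `&` closure (W false) = set0].
Proof.
move=> oV [x [Px Vx]].
have [y [yx Py Vy]] := perfect_kernel_limit_point Px (open_nbhs_nbhs (conj oV Vx)).
have := hK; rewrite open_hausdorff => /(_ _ _ yx)[[A B]/=].
rewrite 2!inE => -[Ay Bx] [oA oB /eqP AB].
have [W [oW Wy WV]] := open_shrink (openI oA oV) (conj Ay Vy).
have [X [oX Xx XV]] := open_shrink (openI oB oV) (conj Bx Vx).
exists (fun b => if b then W else X); split.
- by case; split=> //; [exists y|exists x].
- by case; [move=> z /WV[]|move=> z /XV[]].
- by rewrite -subset0 -AB => z [/WV[? _] /XV[? _]].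
Qed.

(** Modelled on the partial sums of a binary expansion with digits in [0, 1]: the sums increase
    while [S n + 2^-n] decreases, so their supremum is a uniform limit. *)
Lemma binary_limit_continuous (S : nat -> K -> R) :
  (forall n, continuous (S n)) ->
  (forall n x, S n x <= S n.+1 x <= S n x + 2^-1 ^+ n.+1) ->
  exists2 h : K -> R, continuous h
    & forall n x, S n x <= h x <= S n x + 2^-1 ^+ n.
Proof.
move=> cS SS.
have Sle x m n : (m <= n)%N -> S m x <= S n x.
  move=> /subnKC <-; elim: (n - m)%N => [|k IH]; first by rewrite addn0.
  by rewrite addnS (le_trans IH)//; have /andP[] := SS (m + k)%N x.
have Sge x m n : (m <= n)%N -> S n x + 2^-1 ^+ n <= S m x + 2^-1 ^+ m.
  move=> /subnKC <-; elim: (n - m)%N => [|k IH]; first by rewrite addn0.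
  rewrite addnS; apply: le_trans IH; have /andP[_] := SS (m + k)%N x.
  rewrite exprS; lra.
have pow0 n : 0 <= 2^-1 ^+ n :> R by rewrite exprn_ge0// invr_ge0.
have Sub x m n : S m x <= S n x + 2^-1 ^+ n.
  have [mn|/ltnW nm] := leqP m n.
    by rewrite (le_trans (Sle x _ _ mn))// lerDl.
  by rewrite (le_trans _ (Sge x _ _ nm))// lerDl.
pose h x := sup (range (S^~ x)).
have hS n x : S n x <= h x <= S n x + 2^-1 ^+ n.
  apply/andP; split.
    apply: ub_le_sup; last by exists n.
    by exists (S 0%N x + 2^-1 ^+ 0) => _ [m _ <-].
  apply: ge_sup; first by exists (S 0%N x), 0%N.
  by move=> _ [m _ <-].
exists h => //; apply: continuous_uniform_approx => e e0.
have [n ne] := half_pow_small e0.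
exists (S n) => // x; have /andP[h1 h2] := hS n x.
by rewrite ger0_norm ?subr_ge0// lerBlDl (le_trans h2)// lerD2l ltW.
Qed.

Lemma unit_urysohn (A B : set K) : closed A -> closed B -> A `&` B = set0 ->
  exists f : K -> R, [/\ continuous f, forall x, A x -> f x = 0,
    forall x, B x -> f x = 1 & forall x, 0 <= f x <= 1].
Proof.
move=> clA clB AB.
have [f [cf f0 f1 f01]] :=
  @urysohn_ext_itv _ R (compact_normal hK cK) A B 0 1 clA clB AB ltr01.
exists f; split=> // x.
- by move=> Ax; apply: f0; exists x.
- by move=> Bx; apply: f1; exists x.
- by have := f01 _ (imageT f x); rewrite /= in_itv.
Qed.

(** Each binary word [s] gets an open set [V s] meeting the kernel, nested along prefixes, with
    disjoint closures for words of equal length. A function whose binary digits on [V s] are the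
    letters of [s] has values on [U] dense in [0, 1]; compactness of the closure gives all of
    them. *)
Lemma perfect_kernel_onto_interval (U : set K) : open U -> P `&` U !=set0 ->
  exists h : K -> R, [/\ continuous h, forall x, 0 <= h x <= 1
    & `[0, 1]%classic `<=` h @` closure U].
Proof.
move=> oU PU.
have /choice[step stepP] (V : set K) : exists W : bool -> set K,
    open V -> P `&` V !=set0 ->
    [/\ forall b, open (W b) /\ P `&` W b !=set0,
        forall b, closure (W b) `<=` V
      & closure (W true) `&` closure (W false) = set0].
  have [[oV PV]|nV] := pselect (open V /\ P `&` V !=set0).
    by have [W ?] := perfect_kernel_split oV PV; exists W.
  by exists (fun=> V) => oV PV; exfalso; exact: nV.
pose V (s : seq bool) := foldl step U s.
have Vr s b : V (rcons s b) = step (V s) b by rewrite /V foldl_rcons.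
have VP s : open (V s) /\ P `&` V s !=set0.
  elim/last_ind: s => [//|s b [oVs PVs]]; rewrite Vr.
  by have [] := stepP _ oVs PVs.
have Vsub s b : closure (V (rcons s b)) `<=` V s.
  by rewrite Vr; have [_ + _] := stepP _ (VP s).1 (VP s).2.
have VU s : V s `<=` U.
  elim/last_ind: s => [//|s b IH]; apply: subset_trans IH.
  exact: subset_trans (@subset_closure _ _) (Vsub s b).
have Vdisj x s s' : size s = size s' -> closure (V s) x -> closure (V s') x ->
    s = s'.
  elim/last_ind: s s' => [|s b IH] s'; first by case: s'.
  elim/last_ind: s' => [|s' b' _]; first by rewrite size_rcons.
  rewrite !size_rcons => -[ss'] Vx V'x.
  have ess : s = s'.
    by apply: IH => //; apply: subset_closure; apply: Vsub; [exact: Vx|exact: V'x].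
  rewrite -{}ess {ss'} in V'x *; congr rcons.
  have [_ _] := stepP _ (VP s).1 (VP s).2; rewrite -!Vr => Vtf.
  have nV : ~ (closure (V (rcons s true)) `&` closure (V (rcons s false))) x.
    by rewrite Vtf.
  by case: b b' Vx V'x => -[] // ? ?; exfalso; exact: nV.
(* [A n b] belongs to the words of length [n.+1] ending in [b]; the Urysohn function [g n] thus
   reads letter number [n], counted from 0. *)
pose A n b := \bigcup_(s in [set: n.-tuple bool]) closure (V (rcons s b)).
have clA n b : closed (A n b).
  apply: closed_bigcup => [|s _]; first exact: finite_finset.
  exact: closed_closure.
have A0 n : A n false `&` A n true = set0.
  rewrite -subset0 => x [[s _ xs] [s' _ xs']].
  have /Vdisj/(_ xs xs')/rcons_inj[] : size (rcons s false) = size (rcons s' true).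
    by rewrite !size_rcons !size_tuple.
  by [].
have /choice[g gP] n := unit_urysohn (clA n false) (clA n true) (A0 n).
pose fix S n x {struct n} : R := if n is m.+1 then S m x + 2^-1 ^+ m.+1 * g m x else 0.
have cS n : continuous (S n).
  elim: n => [|n IH] x /=; first exact: cvg_cst.
  apply: cvgD; first exact: IH.
  by apply: cvgMr; have [+ _ _ _] := gP n; exact.
have [n x|h ch hS] := binary_limit_continuous cS.
  have [_ _ _ /(_ x)/andP[g0 g1]] := gP n.
  have p0 : 0 <= 2^-1 ^+ n.+1 :> R by rewrite exprn_ge0// invr_ge0.
  by rewrite /= lerDl mulr_ge0// lerD2l ler_piMr.
exists h; split=> // [x|t].
  by have := hS 0%N x; rewrite /= expr0 add0r.
rewrite /= in_itv /= => /andP[t0 t1].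
have approx n : exists s v, [/\ size s = n, forall x, V s x -> S n x = v
    & v <= t <= v + 2^-1 ^+ n].
  elim: n => [|n [s [v [sn Sv /andP[vt tv]]]]].
    by exists [::], 0; split=> //; rewrite expr0 add0r t0.
  (* The next binary digit of [t]: 1 exactly when [t] lies beyond the midpoint of the dyadic
     interval from [v] to [v + 2^-n]. *)
  pose b := v + 2^-1 ^+ n.+1 < t.
  exists (rcons s b), (v + 2^-1 ^+ n.+1 * b%:R); split.
  - by rewrite size_rcons sn.
  - move=> x Vx /=; rewrite Sv; last exact/Vsub/subset_closure/Vx.
    have Ax : A n b x.
      by exists (tcast sn (in_tuple s)) => //; rewrite val_tcast; exact: subset_closure.
    have [_ gf gt _] := gP n; congr (_ + _ * _).
    by case: (b) Ax => [/gt|/gf].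
  - have e2 : 2^-1 ^+ n = 2 * 2^-1 ^+ n.+1 :> R by rewrite exprS mulrA divff ?mul1r.
    rewrite e2 in tv; rewrite /b; move: (_ ^+ n.+1) tv => d tv.
    by case: ltP => vt' /=; apply/andP; split; lra.
have clh : closed (h @` closure U).
  apply: compact_closed; first exact: Rhausdorff.
  apply: continuous_compact; first exact: continuous_subspaceT.
  by apply: subclosed_compact cK _ => //; exact: closed_closure.
apply: clh => B /nbhs_ballP[e /= e0 eB].
have [n ne] := half_pow_small e0.
have [s [v [sn Sv vt]]] := approx n.
have [x [_ Vx]] := (VP s).2.
exists (h x); split; first by exists x => //; exact/subset_closure/VU/Vx.
apply: eB; rewrite /ball /=; have := hS n x; rewrite (Sv x Vx) ltr_norml.
lra.
Qed.

(** Shrinking [U] to [V] first leaves room for a Urysohn function [w] equal to 1 on the closure of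
    [V], which [h] maps onto [0, 1]. *)
Lemma perfect_kernel_bump (U : set K) : open U -> P `&` U !=set0 ->
  exists h w : K -> R,
    [/\ continuous h /\ continuous w,
        forall x, 0 <= h x <= 1, forall x, 0 <= w x <= 1,
        forall x, ~ U x -> w x = 0
      & forall t, 0 <= t <= 1 -> exists x, w x = 1 /\ h x = t].
Proof.
move=> oU [x [Px Ux]].
have [V [oV Vx VU]] := open_shrink oU Ux.
have [|h [ch h01 hV]] := perfect_kernel_onto_interval oV; first by exists x.
have UV : ~` U `&` closure V = set0 by rewrite -subset0 => y [nUy /VU].
have [w [cw w0 w1 w01]] := unit_urysohn (open_closedC oU) (@closed_closure _ V) UV.
exists h, w; split=> // t t01.
by have [|y Vy hy] := hV t; [rewrite /= in_itv|exists y; split=> //; exact: w1].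
Qed.

End Compact.

(** * Continuous functions on copies of a space *)

Section SupNorm.
Variables (R : realType) (X : topologicalType).
Implicit Types f g : cont_fun R X.

Lemma cont_funP (f : X -> R) : continuous f -> (f : X -> R^o) \in @cont_pred R X.
Proof. by move=> cf; apply/asboolP. Qed.

Lemma cont_fun_continuous f : continuous (f : X -> R).
Proof. by case: f => f /= /asboolP. Qed.

Lemma cont_funDE f g x : (f + g) x = f x + g x :> R.
Proof. by []. Qed.

Lemma cont_funZE (a : R) f x : (a *: f) x = a * f x :> R.
Proof. by []. Qed.

Lemma cont_fun_ext f g : (forall x, f x = g x :> R) -> f = g.
Proof. by move=> fg; apply: val_inj; apply/funext. Qed.

Hypothesis cX : compact [set: X].

Lemma sup_norm_ge f x : `|f x : R| <= sup_norm f.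
Proof.
have cf : compact ((fun x => `|f x : R|) @` setT).
  apply: continuous_compact => //; apply: continuous_subspaceT => y.
  by apply: cvg_norm; exact: cont_fun_continuous.
have [_ ubf] := compact_has_sup (ex_intro _ _ (imageT _ x)) cf.
by apply: ub_le_sup => //; exists x.
Qed.

Lemma sup_norm_le f (M : R) : 0 <= M -> (forall x, `|f x : R| <= M) ->
  sup_norm f <= M.
Proof.
move=> M0 fM; rewrite /sup_norm; have [[x _]|nX] := pselect ([set: X] !=set0).
  by apply: ge_sup => [|_ [y _ <-]]; [exists `|f x|, x|exact: fM].
have -> : [set `|f x| | x in [set: X]] = set0.
  by rewrite -subset0 => _ [y _ <-]; apply: nX; exists y.
by rewrite sup0.
Qed.

Lemma sup_norm_attained f : [set: X] !=set0 ->
  exists x, `|f x : R| = sup_norm f.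
Proof.
move=> X0; have [|x _ xM] := @compact_EVT_max X R (fun x => `|f x : R|) setT X0 cX.
  apply: continuous_subspaceT => x; apply: cvg_norm; exact: cont_fun_continuous.
exists x; apply/eqP; rewrite eq_le sup_norm_ge sup_norm_le// => y.
by apply: xM; rewrite inE.
Qed.

End SupNorm.

(** * The unit interval as a compact space *)

Section UnitInterval.
Variable R : realType.
Local Notation I := (unit_interval R).

Lemma unit_interval_valP (t : I) : 0 <= set_val t <= 1.
Proof. by have := set_valP t; rewrite /= in_itv. Qed.

Definition unit_interval_of (t : R) (t01 : 0 <= t <= 1) : I :=
  exist _ t (mem_set (t01 : `[0, 1]%classic t)).

Lemma unit_interval_val_continuous : continuous (set_val : I -> R).
Proof. exact: initial_continuous. Qed.

Lemma unit_interval_of_continuous (X : topologicalType) (h : X -> R)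
    (h01 : forall x, 0 <= h x <= 1) :
  continuous h -> continuous (fun x => unit_interval_of (h01 x)).
Proof.
by move=> ch; exact: (@continuous_comp_initial _ _ _ set_val).
Qed.

Lemma unit_interval_compact : compact [set: I].
Proof.
(* Truncation is total on the line and fixes the points of the interval, so [I] is a continuous
   image of a compact segment. *)
pose clamp (x : R) := Num.min (Num.max x 0) 1.
have c01 x : 0 <= clamp x <= 1.
  by rewrite le_min le_max lexx orbT ler01 ge_min lexx orbT.
rewrite (_ : [set: I] = (fun x => unit_interval_of (c01 x)) @` `[0, 1]%classic).
  apply: continuous_compact; last exact: segment_compact.
  apply/continuous_subspaceT/unit_interval_of_continuous.
  apply: min_fun_continuous; last by move=> x; exact: cvg_cst.
  by apply: max_fun_continuous; [move=> x; exact: cvg_id|move=> x; exact: cvg_cst].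
apply/seteqP; split=> // t _; have /andP[t0 t1] := unit_interval_valP t.
exists (set_val t); first exact: set_valP.
by apply: val_inj; rewrite /= /clamp max_l// min_l.
Qed.

End UnitInterval.

(* Common interface to the finite disjoint union of copies of [L], with
   [copy_limit] zero, and to the one-point compactification of an infinite one,
   with [copy_limit] the value at infinity. *)
Record copies_of (R : realType) (G : Type) (L X : topologicalType) := CopiesOf {
  copy : G -> L -> X;
  copy_limit : cont_fun R X -> R;
  copy_extend : G -> cont_fun R L -> cont_fun R X;
  copy_compact : compact [set: X];
  copy_continuous : forall i, continuous (copy i);
  copy_bound : forall (f : cont_fun R X) (M : R), 0 <= M ->
    (forall i t, `|f (copy i t) : R| <= M) -> forall x, `|f x : R| <= M;
  copy_limit_linear : forall (a : R) f g,
    copy_limit (a *: f + g) = a * copy_limit f + copy_limit g;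
  copy_limit_bound : forall (f : cont_fun R X) (M : R), 0 <= M ->
    (forall x, `|f x : R| <= M) -> `|copy_limit f| <= M;
  copy_limit_finite : forall (f : cont_fun R X) (e : R), 0 < e ->
    finite_set [set i | exists t, e <= `|f (copy i t) - copy_limit f|];
  copy_extendE : forall i f t, copy_extend i f (copy i t) = f t;
  copy_extend0 : forall i j f t, j <> i -> copy_extend i f (copy j t) = 0
}.

(** * Disjoint unions and their one-point compactifications *)

Section Copies.
Variables (R : realType) (G : choiceType) (L : topologicalType).
Hypotheses (cL : compact [set: L]) (l0 : L).
Local Notation S := {_ : G & L}.

Definition sigT_extend_fun (i : G) (f : cont_fun R L) (p : S) : R :=
  if tag p == i then f (tagged p) else 0.

Lemma sigT_extend_fun_continuous i f : continuous (sigT_extend_fun i f).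
Proof.
move=> [j t] A fA.
have cj : continuous (fun t => if j == i then f t : R else 0).
  by case: (j == i) => u; [exact: cont_fun_continuous|exact: cvg_cst].
exact: cj t A fA.
Qed.

Definition sigT_copies : finite_set [set: G] -> copies_of R G L S.
Proof.
move=> finG.
apply: (@CopiesOf R G L S (existT _) (fun=> 0)
  (fun i f => ContFun (cont_funP (@sigT_extend_fun_continuous i f)))).
- exact: sigT_compact.
- by move=> i; exact: existT_continuous.
- by move=> f M M0 fM [i t]; exact: fM.
- by move=> a f g; rewrite mulr0 addr0.
- by move=> f M M0 _; rewrite normr0.
- by move=> f e e0; exact: sub_finite_set finG.
- by move=> i f t; rewrite /= /sigT_extend_fun /= eqxx.
- by move=> i j f t /eqP/negPf ji; rewrite /= /sigT_extend_fun /= ji.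
Qed.

(** Compactness is used as near covering along the filter of ever larger finite index sets: the copy
    through a point is a neighbourhood of it and asks for a single index. *)
Lemma sigT_compact_finite (W : set S) : compact W -> finite_set (tag @` W).
Proof.
move=> /compact_near_coveringP cW.
pose F := filter_from (@finite_set G) (fun A => [set B | A `<=` B]).
have FF : Filter F.
  apply: filter_from_filter; first by exists set0; exact: finite_set0.
  move=> A B fA fB; exists (A `|` B); first by rewrite finite_setU.
  by move=> C /= ABC; split=> x ?; apply: ABC; [left|right].
have [|A fA AW] := cW _ F (fun B p => B (tag p)) FF.
  move=> [i t] _; exists ([set p | tag p = i], [set B | B i]); last first.
    by move=> [p B] /= [->].
  split=> /=; first 
    by apply: filterS (@existT_nbhs G (fun=> L) i t setT filterT) => _ [u _ <-].
  by exists [set i] => // B /= /(_ i); exact.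
apply: sub_finite_set fA => _ [p Wp <-]; exact: AW A (@subset_refl _ A) p Wp.
Qed.

Local Notation X := (one_point_compactification S).

Definition opc_extend_fun (i : G) (f : cont_fun R L) (x : X) : R :=
  if x is Some p then sigT_extend_fun i f p else 0.

Lemma opc_extend_fun_continuous i f : continuous (opc_extend_fun i f).
Proof.
move=> [p|] A; first exact: sigT_extend_fun_continuous.
(* At infinity: the function vanishes off the i-th copy, which is compact and closed. *)
move=> /nbhs_singleton A0; exists (existT _ i @` setT).
  split.
    apply: continuous_compact => //.
    by apply/continuous_subspaceT; exact: existT_continuous.
  rewrite -[_ @` _]setCK; apply: open_closedC; apply/sigT_openP => j.
  have [->|ji] := eqVneq j i.
    rewrite (_ : _ @^-1` _ = set0); first exact: open0.
    by rewrite -subset0 => t /=; apply; exists t.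
  rewrite (_ : _ @^-1` _ = setT); first exact: openT.
  rewrite -subTset => t _ /= [s _ st].
  by have := congr1 (@tag _ _) st; move=> /= /esym/eqP; apply/negP.
move=> _ [[[j t] ni <-]|->]//=; rewrite /sigT_extend_fun /=.
by case: eqP ni => // -> []; exists t.
Qed.

(** Off a compact subset of the disjoint union [f] is within [e] of its value at infinity, and that
    subset meets only finitely many copies. *)
Lemma opc_limit_finite (f : cont_fun R X) (e : R) : 0 < e ->
  finite_set [set i | exists t, e <= `|f (Some (existT _ i t)) - f None|].
Proof.
move=> e0; have /cvgrPdist_lt/(_ _ e0)[W [cW _] Wf] :=
  cont_fun_continuous (f := f) (x := None).
apply: sub_finite_set (sigT_compact_finite cW) => i [t]; rewrite distrC => le_e.
exists (existT _ i t) => //; apply: contrapT => nW.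
have := Wf (Some (existT _ i t)); rewrite /= ltNge le_e => ff.
by apply: notF; apply: ff; left; exists (existT _ i t).
Qed.

Definition opc_copies : infinite_set [set: G] -> copies_of R G L X.
Proof.
move=> infG.
apply: (@CopiesOf R G L X (fun i t => Some (existT _ i t)) (fun f => f None)
  (fun i f => ContFun (cont_funP (@opc_extend_fun_continuous i f)))).
- exact: one_point_compactification_compact.
- by move=> i t A.
- move=> f M M0 fM [[i t]|]; first exact: fM.
  (* If the bound failed at infinity, [f] would deviate from [f None] by at least [|f None| - M] on
     each of the infinitely many copies. *)
  rewrite leNgt; apply/negP => Mf.
  have e0 : 0 < `|f None : R| - M by rewrite subr_gt0.
  apply: infG; apply: sub_finite_set (@opc_limit_finite f _ e0) => i _; exists l0.
  rewrite distrC (le_trans _ (lerB_dist _ _))//.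
  exact: lerB.
- by [].
- by move=> f M M0; exact.
- exact: opc_limit_finite.
- by move=> i f t; rewrite /= /sigT_extend_fun /= eqxx.
- by move=> i j f t /eqP/negPf ji; rewrite /= /sigT_extend_fun /= ji.
Qed.

Definition copies_copies : copies_of R G L (copies G L).
Proof.
by rewrite /copies; case: asboolP; [exact: sigT_copies|exact: opc_copies].
Qed.

End Copies.

(** * Isometric embeddings *)

Section IsometryOnInterval.
Variables (R : realType) (K : topologicalType).
Hypothesis cK : compact [set: K].
Local Notation I := (unit_interval R).

Definition interval_cst : cont_fun R I :=
  ContFun (cont_funP (@cst_continuous I R 1)).

Definition interval_val : cont_fun R I :=
  ContFun (cont_funP (@unit_interval_val_continuous R)).

Lemma tent_continuous (X : topologicalType) (g : X -> R) (t : R) :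
  continuous g -> continuous (fun x => 1 - `|g x - t|).
Proof.
move=> cg x; apply: cvgB; first exact: cvg_cst.
by apply: cvg_norm; apply: cvgB; [exact: cg|exact: cvg_cst].
Qed.

Definition tent (t : R) : cont_fun R I :=
  ContFun (cont_funP (tent_continuous (t := t) (@unit_interval_val_continuous R))).

(** The sum of the constant 1 and [tent t] has norm 2, so where its image attains the norm, the
    images of both summands are 1 or both are -1. Perturbing the tent then forces
    [T interval_val x = t * T interval_cst x]. *)
Lemma isometry_interval_onto (T : cont_fun R I -> cont_fun R K) :
  (forall (a : R) f g, T (a *: f + g) = a *: T f + T g) ->
  (forall f, sup_norm (T f) = sup_norm f) ->
  forall t, 0 <= t <= 1 -> exists x, `|T interval_cst x : R| = 1 /\
    T interval_val x * T interval_cst x = t :> R.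
Proof.
move=> Tlin Tiso t t01; have /andP[t0 t1] := t01.
have cI := @unit_interval_compact R.
have le (f : cont_fun R I) x (M : R) :
    0 <= M -> (forall s, `|f s : R| <= M) -> `|T f x : R| <= M.
  move=> M0 fM; apply: le_trans (sup_norm_ge cK _ x) _.
  by rewrite Tiso; exact: sup_norm_le.
have tentP s : 0 <= 1 - `|set_val (s : I) - t| <= 1.
  have /andP[s0 s1] := unit_interval_valP s.
  by rewrite subr_ge0 gerBl normr_ge0 andbT ler_norml; apply/andP; split; lra.
have K0 : [set: K] !=set0.
  apply: contrapT => nK; have : sup_norm (T interval_cst) <= 0.
    by apply: sup_norm_le => // x; exfalso; apply: nK; exists x.
  rewrite Tiso leNgt => /negP; apply.
  apply: lt_le_trans (sup_norm_ge cI _ (unit_interval_of t01)).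
  by rewrite /= normr1 ltr01.
have [x Tx] := sup_norm_attained cK (T (1 *: interval_cst + tent t)) K0.
have {}Tx : 2 <= `|T interval_cst x + T (tent t) x : R|.
  move: Tx; rewrite Tiso Tlin !scale1r cont_funDE => ->.
  apply: le_trans (sup_norm_ge cI _ (unit_interval_of t01)).
  by rewrite cont_funDE /= subrr normr0 subr0 ger0_norm; lra.
have c1 : `|T interval_cst x : R| <= 1.
  by apply: le => // s; rewrite /= normr1.
have u1 : `|T (tent t) x : R| <= 1.
  by apply: le => // s; have /andP[? ?] := tentP s; rewrite /= ger0_norm.
(* Both [tent t + (val - t)] and [tent t - (val - t)] have norm at most one, and
   the functional [T _ x] takes its maximal value on [tent t]. *)
have pm (e : R) : `|e| = 1 ->
    `|T (tent t) x + e * (T interval_val x - t * T interval_cst x) : R| <= 1.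
  move=> e1.
  have -> : T (tent t) x + e * (T interval_val x - t * T interval_cst x) =
      T (e *: ((- t) *: interval_cst + interval_val) + tent t) x :> R.
    by rewrite !Tlin !(cont_funDE, cont_funZE); ring.
  apply: le => // s.
  rewrite !(cont_funDE, cont_funZE) /=.
  have -> : e * (- t * 1 + set_val s) = e * (set_val s - t) by ring.
  have : `|e * (set_val s - t)| = `|set_val s - t| by rewrite normrM e1 mul1r.
  have /andP[] := tentP s; move: (e * _) => y ? ? ye.
  rewrite -ye in tentP *.
  by have := ler_norm y; have := ler_norm (- y); rewrite normrN ler_norml => *;
    apply/andP; split; lra.
have := pm 1 (normr1 _); have := pm (- 1) (normrN1 _).
move: Tx c1 u1; set c : R := T interval_cst x; set u : R := T (tent t) x.
set v : R := T interval_val x => Tx c1 u1 pm1 pm2.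
exists x; rewrite -/c -/v.
move: Tx; rewrite ler_normr => /orP[cu|cu].
  have [cE uE] : c = 1 /\ u = 1 by move: c1 u1; rewrite !ler_norml; split; lra.
  by move: pm1 pm2; rewrite cE uE normr1 !ler_norml; split=> //; lra.
have [cE uE] : c = -1 /\ u = -1 by move: c1 u1; rewrite !ler_norml; split; lra.
by move: pm1 pm2; rewrite cE uE normrN1 !ler_norml; split=> //; lra.
Qed.

Lemma isometry_interval_kernel (T : cont_fun R I -> cont_fun R K) :
  (forall (a : R) f g, T (a *: f + g) = a *: T f + T g) ->
  (forall f, sup_norm (T f) = sup_norm f) ->
  exists x, perfect_kernel K x /\ `|T interval_cst x : R| = 1.
Proof.
move=> Tlin Tiso; have onto := isometry_interval_onto Tlin Tiso.
pose F := [set x | `|T interval_cst x : R| = 1].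
have [] := @interval_image_meets_kernel R K F
  (fun x => T interval_val x * T interval_cst x) cK.
- apply: (@closed_comp _ _ (fun x => `|T interval_cst x : R|) [set 1]).
    by move=> x _; apply: cvg_norm; exact: cont_fun_continuous.
  exact: closed_eq.
- by move=> x; apply: cvgM; exact: cont_fun_continuous.
- move=> t; rewrite /= in_itv => /= t01.
  by have [x [? ?]] := onto t t01; exists x.
- by move=> x [Fx Px]; exists x.
Qed.

End IsometryOnInterval.

(** * Passing between isometric embeddings and cellular families *)

Section CopiesEmbedding.
Variables (R : realType) (K X : topologicalType) (G : choiceType).
Hypotheses (cK : compact [set: K]) (hK : hausdorff_space K).
Local Notation I := (unit_interval R).
Variable C : copies_of R G I X.

Let cI := @unit_interval_compact R.

Lemma copy_extend_bound i (f : cont_fun R I) (M : R) :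
  0 <= M -> (forall t, `|f t : R| <= M) ->
  forall x, `|copy_extend C i f x : R| <= M.
Proof.
move=> M0 fM x; apply: (copy_bound (c := C)) => // j t.
have [->|/eqP ji] := eqVneq j i; first by rewrite copy_extendE.
by rewrite copy_extend0// normr0.
Qed.

(** This is [copy_bound] with bound 0 for the difference: what vanishes on the copies vanishes at
    infinity as well. *)
Lemma copy_ext (f g : cont_fun R X) :
  (forall i t, f (copy C i t) = g (copy C i t) :> R) -> f = g.
Proof.
move=> fg; apply: cont_fun_ext => x; apply/eqP; rewrite -subr_eq0 -normr_le0.
have -> : f x - g x = ((-1) *: g + f) x :> R.
  by rewrite cont_funDE cont_funZE; ring.
apply: (copy_bound (c := C)) => // i t.
by rewrite cont_funDE cont_funZE fg mulN1r addNr normr0.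
Qed.

Lemma copy_extend_linear i (a : R) (f g : cont_fun R I) :
  copy_extend C i (a *: f + g) = a *: copy_extend C i f + copy_extend C i g.
Proof.
apply: copy_ext => j t; rewrite cont_funDE cont_funZE.
have [->|/eqP ji] := eqVneq j i; first by rewrite !copy_extendE.
by rewrite !copy_extend0// mulr0 addr0.
Qed.

Lemma copy_extend_norm i (f : cont_fun R I) :
  sup_norm (copy_extend C i f) = sup_norm f.
Proof.
have norm_ge0 : 0 <= sup_norm f.
  have h01 : 0 <= (0 : R) <= 1 by rewrite lexx ler01.
  exact: le_trans (normr_ge0 _) (sup_norm_ge cI f (unit_interval_of h01)).
have ext_ge0 : 0 <= sup_norm (copy_extend C i f).
  have h01 : 0 <= (0 : R) <= 1 by rewrite lexx ler01.
  exact: le_trans (normr_ge0 _)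
    (sup_norm_ge (copy_compact C) _ (copy C i (unit_interval_of h01))).
apply/eqP; rewrite eq_le !sup_norm_le// => [t|x].
  rewrite -(copy_extendE C i f t); exact/sup_norm_ge/(copy_compact C).
by apply: copy_extend_bound => // t; exact: sup_norm_ge.
Qed.

Lemma embedding_cellular (T : {linear cont_fun R X -> cont_fun R K}) :
  (forall f, sup_norm (T f) = sup_norm f) ->
  exists U : set (set K), [/\ cellular_family U,
    forall u, U u -> perfect_kernel K `&` u !=set0 & ([set: G] #= U)%card].
Proof.
move=> Tiso; pose E i := copy_extend C i (interval_cst R).
pose U i := [set x | 1 / 2 < `|T (E i) x : R|].
have oU i : open (U i).
  apply: (@open_comp _ _ (fun x => `|T (E i) x : R|) [set y | 1 / 2 < y]).
    by move=> x _; apply: cvg_norm; exact: cont_fun_continuous.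
  exact: open_gt.
have PU i : perfect_kernel K `&` U i !=set0.
  have [||x [Px Tx]] := @isometry_interval_kernel R K cK (fun f => T (copy_extend C i f)).
  - by move=> a f g; rewrite copy_extend_linear linearP.
  - by move=> f; rewrite Tiso copy_extend_norm.
  by exists x; split=> //; rewrite /U /= Tx; lra.
have Udisj i j x : U i x -> U j x -> i = j.
  move=> Ui Uj; apply: contrapT => ij.
  have bound (e : R) : `|e| = 1 -> `|e * T (E i) x + T (E j) x : R| <= 1.
    move=> e1.
    have -> : e * T (E i) x + T (E j) x = T (e *: E i + E j) x :> R.
      by rewrite linearP.
    apply: le_trans (sup_norm_ge cK _ x) _; rewrite Tiso.
    apply: sup_norm_le => //; apply: (copy_bound (c := C)) => // k t.
    rewrite cont_funDE cont_funZE /E.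
    have [->|/eqP ki] := eqVneq k i.
      by rewrite copy_extendE copy_extend0//= addr0 mulr1 e1.
    rewrite copy_extend0// mulr0 add0r.
    have [->|/eqP kj] := eqVneq k j; first by rewrite copy_extendE /= normr1.
    by rewrite copy_extend0// normr0.
  (* For one of the two signs the terms do not cancel, and their sum would exceed 1 in absolute
     value. *)
  have := bound 1 (normr1 _); have := bound (- 1) (normrN1 _).
  move: Ui Uj; rewrite /U /= !ltr_normr !ler_norml.
  by move=> /orP[?|?] /orP[?|?]; lra.
exists (range U); split.
- split=> [_ [i _ <-]|_ _ [i _ <-] [j _ <-] [x [Ui Uj]]].
    by split=> //; have [x [_ ?]] := PU i; exists x.
  by rewrite (Udisj i j x).
- by move=> _ [i _ <-].
(* Nonempty disjoint sets are distinct, so [U] is injective. *)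
- rewrite card_eq_sym; apply: inj_card_eq => i j _ _ Uij.
  by have [x [_ Ui]] := PU i; apply: (Udisj i j x) => //; rewrite -Uij.
Qed.

Lemma cellular_embedding (g0 : G) (u : G -> set K) :
  (forall i, open (u i)) -> (forall i, perfect_kernel K `&` u i !=set0) ->
  (forall i j x, u i x -> u j x -> i = j) -> isometrically_embeds R X K.
Proof.
move=> ou Pu udisj.
have /choice[h /choice[w hw]] i := perfect_kernel_bump R cK hK (ou i) (Pu i).
have h01 i x : 0 <= h i x <= 1 by have [_ + _ _ _] := hw i; exact.
have w01 i x : 0 <= w i x <= 1 by have [_ _ + _ _] := hw i; exact.
have w0 i x : ~ u i x -> w i x = 0 by have [_ _ _ + _] := hw i; exact.
(* [idx x] is the index of the set containing [x]; if there is none its value is immaterial, since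
   all bumps vanish at [x]. *)
have /choice[idx idxP] x : exists i, forall j, u j x -> i = j.
  have [[i ui]|nu] := pselect (exists i, u i x).
    by exists i => j; exact: udisj ui.
  by exists g0 => j uj; exfalso; apply: nu; exists j.
(* [T f] is a convex combination of [copy_limit C f] and of one value of [f],
   since at most one of the bumps [w i] is nonzero at each point. *)
pose term (f : cont_fun R X) i x : R :=
  w i x * (f (copy C i (unit_interval_of (h01 i x))) - copy_limit C f).
pose Tf (f : cont_fun R X) x : R := copy_limit C f + term f (idx x) x.
have cterm f i : continuous (term f i).
  have [[ch cw] _ _ _ _] := hw i.
  move=> x; apply: cvgM; first exact: cw.
  apply: cvgB; last exact: cvg_cst.
  apply: (@continuous_comp _ _ _ (fun x => copy C i (unit_interval_of (h01 i x))) f).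
    apply: (@continuous_comp _ _ _ (fun x => unit_interval_of (h01 i x)) (copy C i)).
      exact: unit_interval_of_continuous.
    exact: copy_continuous.
  exact: cont_fun_continuous.
(* Only finitely many copies carry values of [f] at distance at least [e] from the limit; the sum of
   their terms approximates [Tf f] uniformly, each omitted term being below [e]. *)
have cTf f : continuous (Tf f).
  apply: continuous_uniform_approx => e e0.
  have /finite_seqP[s sE] := copy_limit_finite C f e0.
  exists (fun x => copy_limit C f + \sum_(i <- undup s) term f i x).
    move=> x; apply: cvgD; first exact: cvg_cst.
    apply: continuous_big => [|i _]; last exact: cterm.
    exact: (@add_continuous R^o).
  move=> x; rewrite /Tf opprD addrACA subrr add0r.
  have t0 i : i != idx x -> term f i x = 0.
    move=> ix; rewrite /term w0 ?mul0r// => /idxP xi.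
    by rewrite xi eqxx in ix.
  have [xs|xs] := boolP (idx x \in s).
    rewrite (bigD1_seq (idx x)) ?mem_undup ?undup_uniq//= big1 ?addr0 ?subrr ?normr0 ?ltW//.
  rewrite big1_seq => [|i /andP[_]]; last first.
    rewrite mem_undup => si; apply: t0; apply: contraNneq xs => <- //.
  rewrite subr0 /term normrM; have /andP[w0' w1'] := w01 (idx x) x.
  rewrite (ger0_norm w0'); set y := unit_interval_of _.
  have ye : `|f (copy C (idx x) y) - copy_limit C f| < e.
    rewrite ltNge; apply/negP => le_e; move/negP: xs; apply.
    suff : [set` s] (idx x) by [].
    by rewrite -sE; exists y.
  by rewrite (le_trans (ler_piMl _ w1'))// ltW.
pose T f : cont_fun R K := ContFun (cont_funP (@cTf f)).
have Tlin : linear T.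
  move=> a f g; apply: cont_fun_ext => x; rewrite cont_funDE cont_funZE /=.
  rewrite /Tf /term copy_limit_linear cont_funDE cont_funZE; ring.
pose L : {linear cont_fun R X -> cont_fun R K} :=
  HB.pack T (GRing.isLinear.Build _ _ _ _ T Tlin).
exists L => f; rewrite /L /=.
have Tval i x : w i x = 1 -> T f x = f (copy C i (unit_interval_of (h01 i x))) :> R.
  move=> w1; have ui : u i x.
    by apply: contrapT => /w0; rewrite w1 => /eqP; rewrite oner_eq0.
  by rewrite /= /Tf (idxP x i ui) /term w1; ring.
have [x0 _] := Pu g0.
have fN0 : 0 <= sup_norm f.
  apply: le_trans (normr_ge0 _) (sup_norm_ge (copy_compact C) f (copy C g0 _)).
  exact: unit_interval_of (h01 g0 x0).
have TN0 : 0 <= sup_norm (T f).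
  exact: le_trans (normr_ge0 _) (sup_norm_ge cK _ x0).
have fN x : `|f x : R| <= sup_norm f by apply: sup_norm_ge (copy_compact C) _ _.
apply/eqP; rewrite eq_le !sup_norm_le//; last first.
  move=> x; rewrite /= /Tf /term; set y := copy C _ _.
  have := copy_limit_bound C fN0 fN; have := fN y; have := w01 (idx x) x.
  move: (w _ _) (copy_limit _ _) (f y : R) => a c d /andP[a0 a1] dN cN.
  have -> : c + a * (d - c) = (1 - a) * c + a * d by ring.
  rewrite (le_trans (ler_normD _ _))// !normrM (ger0_norm a0) ger0_norm; last lra.
  nra.
(* Lower bound for the norm: every [t] is [h i x] for some [x] with [w i x = 1], and there [T f x]
   is the value of [f] at the point [t] of the i-th copy. *)
apply: (copy_bound (c := C)) => // i t.
have [_ _ _ _ /(_ _ (unit_interval_valP t))[x [w1 hx]]] := hw i.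
have -> : t = unit_interval_of (h01 i x) by apply: val_inj.
rewrite -Tval//; exact: sup_norm_ge.
Qed.

End CopiesEmbedding.

(** * Equality of the two suprema *)

Theorem theorem1p4 (R : realType) (K : topologicalType)
    (Kcompact : compact [set: K]) (Khausdorff : hausdorff_space K)
    (Kinfinite : infinite_set [set: K]) :
  exists k : choiceType,
    is_relative_cellularity (perfect_kernel K) k /\
    is_card_sup (fun G : choiceType =>
      inhabited G /\
      isometrically_embeds R (copies G (unit_interval R)) K) k.
Proof.
have h0 : 0 <= (0 : R) <= 1 by rewrite lexx ler01.
have C (G : choiceType) := @copies_copies R G _
  (@unit_interval_compact R) (unit_interval_of h0).
pose F (G : choiceType) := exists U : set (set K),
  [/\ cellular_family U, forall u, U u -> perfect_kernel K `&` u !=set0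
    & ([set: G] #= U)%card].
(* Cellular families are sets of subsets of [K], so [set K] bounds their cardinalities. *)
have [|k [kF kmin]] := @is_card_sup_exists F [set: set K].
  move=> G [U [_ _ GU]].
  by rewrite (card_le_eqr (card_setT _)) (card_le_eql GU); exact: card_leT.
exists k; split; first by split.
have embF (G : choiceType) : inhabited G ->
    isometrically_embeds R (copies G (unit_interval R)) K <-> F G.
  move=> [g0]; split=> [[T Tiso]|[U [[Uo Utriv] PU GU]]].
    exact: (embedding_cellular Kcompact (C G) Tiso).
  have /pcard_leP/unsquash u : ([set: G] #<= U)%card.
    by move: GU; rewrite card_eq_le => /andP[].
  have Uu i : U (u i) by exact: (@funS _ _ _ _ u i I).
  apply: (cellular_embedding Kcompact Khausdorff (C G) g0 (u := u)) => [i|i|i j x ui uj].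
  - exact: (Uo _ (Uu i)).1.
  - exact: PU.
  - have uij : u i = u j by apply: (Utriv _ _ (Uu i) (Uu j)); exists x.
    by apply: (@inj _ _ _ u) uij; rewrite inE.
split=> [G [/embF GF /GF]|k' Fk']; first exact: kF.
(* The two index classes differ at most in empty types, whose cardinality is below every bound. *)
apply: kmin => G FG; have [[g0]|nG] := pselect (inhabited G).
  by apply: Fk'; split=> //; apply/embF.
have -> : [set: G] = set0 by rewrite -subset0 => g _; apply: nG; exists; exact: g.
exact: card_ge0.
Qed.
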